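(* Let $R$ be a non-collapsing TRS over $\Sigma$ and let $\mathcal{A}=(A,[\![\cdot]\!])$ be a core partial model for $R$. Then $R$ is terminating on $\mathcal{L}(\mathcal{A})$ if and only if the labelled TRS $\mathrm{lab}_{\mathcal{A}}(R)$ is terminating on all terms over its signature $\mathrm{lab}_{\mathcal{A}}(\Sigma)$.
   Context: A TRS over $\Sigma$ is a set of rules $\ell\to r$ ($\ell\notin\mathcal{X}$, $\mathrm{Var}(r)\subseteq\mathrm{Var}(\ell)$); it is non-collapsing if no right-hand side is a variable. $R$ is terminating on a set $T$ if no $t\in T$ admits an infinite $\to_R$-sequence. A partial $\Sigma$-algebra $\mathcal{A}=(A,[\![\cdot]\!])$: non-empty $A$, partial functions $[\![f]\!]:A^n\rightharpoonup A$; interpretation under $\alpha:\mathcal{X}\to A$: $[\![x]\!]_\alpha=\alpha(x)$, $[\![f(t_1,\dots,t_n)]\!]_\alpha=[\![f]\!]([\![t_1]\!]_\alpha,\dots,[\![t_n]\!]_\alpha)$, defined only if all subexpressions are; $[\![t]\!]$ for ground $t$. $\mathcal{A}$ is a partial model for $R$ if for all $\ell\to r\in R$ and $\alpha:\mathrm{Var}(\ell)\to A$, if $[\![\ell]\!]_\alpha$ is defined then $[\![r]\!]_\alpha$ is defined and $[\![\ell]\!]_\alpha=[\![r]\!]_\alpha$. The language is $\mathcal{L}(\mathcal{A})=\{t\in\mathcal{T}(\Sigma,\emptyset)\mid [\![t]\!]\text{ defined}\}$. The core of $\mathcal{A}$ is the smallest $C\subseteq A$ with $[\![f]\!](a_1,\dots,a_n)\in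 C$ whenever $a_1,\dots,a_n\in C$ and this value is defined; $\mathcal{A}$ is core if $A$ equals its core. Labelling: $\mathrm{lab}_{\mathcal{A}}(\Sigma)=\{f^{\lambda}\mid f\in\Sigma,\ \lambda\in A^{\mathrm{ar}(f)},\ [\![f]\!](\lambda)\text{ defined}\}$ with $f^\lambda$ of arity $\mathrm{ar}(f)$. For $t$ and $\alpha:\mathrm{Var}(t)\to A$ with $[\![t]\!]_\alpha$ defined, $\mathrm{lab}_\alpha(x)=x$ and $\mathrm{lab}_\alpha(f(t_1,\dots,t_n))=f^{([\![t_1]\!]_\alpha,\dots,[\![t_n]\!]_\alpha)}(\mathrm{lab}_\alpha(t_1),\dots,\mathrm{lab}_\alpha(t_n))$. Then $\mathrm{lab}_{\mathcal{A}}(R)=\{\mathrm{lab}_\alpha(\ell)\to\mathrm{lab}_\alpha(r)\mid \ell\to r\in R,\ \alpha:\mathrm{Var}(\ell)\to A,\ [\![\ell]\!]_\alpha\text{ defined}\}$. *)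

(* Defs.v *)
From mathcomp Require Import all_boot.

Set Implicit Arguments.
Unset Strict Implicit.
Unset Printing Implicit Defensive.

Record signature := Signature { symbol : Type; arity : symbol -> nat }.

(* First-order terms over Sg with variables in X.  Argument tuples are finite
   functions, so Leibniz equality of terms is syntactic equality. *)
Inductive term (Sg : signature) (X : Type) : Type :=
| Var of X
| App (f : symbol Sg) of {ffun 'I_(arity f) -> term Sg X}.

Arguments Var {Sg X} x.
Arguments App {Sg X} f ts.

Definition is_var (Sg : signature) (X : Type) (t : term Sg X) : bool :=
  if t is Var _ then true else false.

Fixpoint occurs (Sg : signature) (X : Type) (x : X) (t : term Sg X) : Prop :=
  match t with
  | Var y => x = y
  | App f ts => exists i : 'I_(arity f), occurs x (ts i)
  end.

Definition ground (Sg : signature) (X : Type) (t : term Sg X) : Prop :=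
  forall x : X, ~ occurs x t.

Fixpoint subst (Sg : signature) (X : Type) (s : X -> term Sg X)
    (t : term Sg X) : term Sg X :=
  match t with
  | Var x => s x
  | App f ts => App f [ffun i => subst s (ts i)]
  end.

Definition rules (Sg : signature) (X : Type) := term Sg X -> term Sg X -> Prop.

Definition is_trs (Sg : signature) (X : Type) (R : rules Sg X) : Prop :=
  forall l r, R l r ->
    ~~ is_var l /\ (forall x : X, occurs x r -> occurs x l).

Definition non_collapsing (Sg : signature) (X : Type) (R : rules Sg X) : Prop :=
  forall l r, R l r -> ~~ is_var r.

Inductive rewrite_step (Sg : signature) (X : Type) (R : rules Sg X) :
    term Sg X -> term Sg X -> Prop :=
| step_root (l r : term Sg X) (s : X -> term Sg X) :
    R l r -> rewrite_step R (subst s l) (subst s r)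
| step_arg (f : symbol Sg) (ts : {ffun 'I_(arity f) -> term Sg X})
    (i : 'I_(arity f)) (u : term Sg X) :
    rewrite_step R (ts i) u ->
    rewrite_step R (App f ts) (App f [ffun j => if j == i then u else ts j]).

Definition terminating_on (Sg : signature) (X : Type) (R : rules Sg X)
    (T : term Sg X -> Prop) : Prop :=
  forall t, T t ->
    ~ exists s : nat -> term Sg X,
        s 0 = t /\ forall n, rewrite_step R (s n) (s n.+1).

(* None means undefined. *)
Record partial_algebra (Sg : signature) := PartialAlgebra {
  carrier : Type;
  carrier_inhabited : inhabited carrier;
  interp : forall f : symbol Sg, {ffun 'I_(arity f) -> carrier} -> option carrier
}.

Definition oget (T : Type) (o : option T) : o -> T :=
  match o with
  | Some x => fun _ => x
  | None => fun h => match notF h with end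
  end.

(* A tuple of possibly undefined values is a tuple of values if every component
   is defined, and is undefined otherwise. *)
Definition otuple (T : Type) (n : nat) (F : {ffun 'I_n -> option T}) :
    option {ffun 'I_n -> T} :=
  match @forallP _ (fun i => F i : bool) with
  | ReflectT h => Some [ffun i => oget (h i)]
  | ReflectF _ => None
  end.

Lemma otupleP (T : Type) (n : nat) (F : {ffun 'I_n -> option T})
    (v : {ffun 'I_n -> T}) :
  otuple F = Some v <-> forall i, F i = Some (v i).
Proof.
have ogetK (o : option T) (h : o) : o = Some (oget h) by case: o h.
rewrite /otuple; case: forallP => h; split.
- by move=> [<-] i; rewrite ffunE -ogetK.
- move=> Fv; congr Some; apply/ffunP => i; rewrite ffunE.
  by apply: Some_inj; rewrite -ogetK Fv.
- by [].
- by move=> Fv; case: h => i; rewrite Fv.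
Qed.

Fixpoint eval (Sg : signature) (X : Type) (A : partial_algebra Sg)
    (alpha : X -> carrier A) (t : term Sg X) : option (carrier A) :=
  match t with
  | Var x => Some (alpha x)
  | App f ts => obind (@interp Sg A f) (otuple [ffun i => eval alpha (ts i)])
  end.

(* Assignments are total on X; as the carrier is inhabited, every assignment on
   the variables of l extends to one, and only the values on these variables
   matter. *)
Definition partial_model (Sg : signature) (X : Type) (R : rules Sg X)
    (A : partial_algebra Sg) : Prop :=
  forall l r (alpha : X -> carrier A), R l r -> eval alpha l ->
    eval alpha r /\ eval alpha l = eval alpha r.

(* The value of a ground term does not depend on alpha, and some alpha exists
   as the carrier is inhabited. *)
Definition language (Sg : signature) (X : Type) (A : partial_algebra Sg)
    (t : term Sg X) : Prop :=
  ground t /\ exists alpha : X -> carrier A, eval alpha t.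

Arguments language {Sg} X A t.

Inductive core (Sg : signature) (A : partial_algebra Sg) : carrier A -> Prop :=
| core_interp (f : symbol Sg) (v : {ffun 'I_(arity f) -> carrier A})
    (a : carrier A) :
    (forall i, core (v i)) -> interp v = Some a -> core a.

Definition is_core (Sg : signature) (A : partial_algebra Sg) : Prop :=
  forall a : carrier A, core a.

Definition lab_symbol (Sg : signature) (A : partial_algebra Sg) : Type :=
  {f : symbol Sg & {v : {ffun 'I_(arity f) -> carrier A} | interp v}}.

Definition lab_sig (Sg : signature) (A : partial_algebra Sg) : signature :=
  @Signature (lab_symbol A) (fun g => arity (tag g)).

(* lab alpha t is None exactly when eval alpha t is undefined (see labE). *)
Fixpoint lab (Sg : signature) (X : Type) (A : partial_algebra Sg)
    (alpha : X -> carrier A) (t : term Sg X) : option (term (lab_sig A) X) :=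
  match t with
  | Var x => Some (Var x)
  | App f ts =>
      if otuple [ffun i => eval alpha (ts i)] is Some v then
        if (insub v : {? w : {ffun 'I_(arity f) -> carrier A} | interp w})
           is Some w then
          omap (@App (lab_sig A) X (existT _ f w))
               (otuple [ffun i => lab alpha (ts i)])
        else None
      else None
  end.

Definition lab_rules (Sg : signature) (X : Type) (A : partial_algebra Sg)
    (R : rules Sg X) : rules (lab_sig A) X :=
  fun l' r' => exists l r (alpha : X -> carrier A),
    [/\ R l r, eval alpha l, lab alpha l = Some l' & lab alpha r = Some r'].

Arguments lab_rules {Sg X} A R l' r'.

Lemma term_ind' (Sg : signature) (X : Type) (P : term Sg X -> Prop) :
  (forall x, P (Var x)) ->
  (forall f (ts : {ffun 'I_(arity f) -> term Sg X}),
     (forall i, P (ts i)) -> P (App f ts)) ->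
  forall t, P t.
Proof. by move=> PV PA; fix IH 1 => -[x|f ts]; [exact: PV|apply: PA => i; exact: IH]. Qed.

Lemma labE (Sg : signature) (X : Type) (A : partial_algebra Sg)
    (alpha : X -> carrier A) (t : term Sg X) :
  lab alpha t = eval alpha t :> bool.
Proof.
elim/term_ind': t => [//|f ts IH] /=.
case Ev: (otuple _) => [v|//] /=.
have {}IH i : lab alpha (ts i).
  by rewrite IH; move/otupleP/(_ i): Ev; rewrite ffunE => ->.
case: insubP => [w iv _|/negbTE ->] //; rewrite iv.
suff -> : otuple [ffun i => lab alpha (ts i)] =
          Some [ffun i => oget (IH i)] by [].
by apply/otupleP => i; rewrite !ffunE; case: (lab _ _) (IH i).
Qed.

Lemma lab_is_var (Sg : signature) (X : Type) (A : partial_algebra Sg)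
    (alpha : X -> carrier A) (t : term Sg X) (t' : term (lab_sig A) X) :
  lab alpha t = Some t' -> is_var t' = is_var t.
Proof.
case: t => [x [<-]//|f ts] /=.
by case: (otuple _) => //= v; case: insub => // w; case: (otuple _) => //= ? [<-].
Qed.

Lemma lab_occurs (Sg : signature) (X : Type) (A : partial_algebra Sg)
    (alpha : X -> carrier A) (t : term Sg X) (t' : term (lab_sig A) X) (x : X) :
  lab alpha t = Some t' -> occurs x t' <-> occurs x t.
Proof.
elim/term_ind': t t' => [y t' [<-]//|f ts IH] t' /=.
case: (otuple _) => //= v; case: insub => // w.
case Eu: (otuple _) => [us|//] /= [<-] /=.
have {}IH i : occurs x (us i) <-> occurs x (ts i).
  by apply: IH; move/otupleP/(_ i): Eu; rewrite ffunE.
by split=> -[i xi]; exists i; apply/IH.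
Qed.

Lemma lab_rules_trs (Sg : signature) (X : Type) (A : partial_algebra Sg)
    (R : rules Sg X) :
  is_trs R -> is_trs (lab_rules A R).
Proof.
move=> trsR l' r' [l [r [alpha [Rlr _ El Er]]]]; have [nvl sub] := trsR _ _ Rlr.
split=> [|x]; first by rewrite (lab_is_var El).
by move/(lab_occurs x Er)/sub/(lab_occurs x El).
Qed.

(* Main.v *)
Require Import Defs.
From mathcomp Require Import all_boot.
From mathcomp Require Import boolp.

(** A labelled symbol [f^v] is read as a sorted symbol with argument sorts [v]
    and result sort [[f](v)]; labelled terms need not be well-sorted.

    If the labelled system terminates, so does [R] on the language, because
    labelling turns every [R]-step into a labelled step.

    Conversely, [cap a t] erases the labels of the largest well-sorted top part
    of [t] of sort [a], and replaces the maximal subterms at which the sort is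
    wrong (the aliens) by a fixed ground term of the required value, which
    exists because the algebra is core.  The result lies in the language.  As no
    right-hand side is a variable, rewriting an alien does not change its sort,
    so aliens never merge with the cap above them: a step either rewrites
    the cap or takes place inside an alien and leaves the cap unchanged.  Hence
    a term with terminating cap and terminating aliens is terminating, and
    termination of all labelled terms follows by structural induction, as the
    aliens of a term are proper subterms. *)

Set Implicit Arguments.
Unset Strict Implicit.
Unset Printing Implicit Defensive.

(** * Strong normalisation as accessibility, and its link with infinite sequences *)

Definition sn (T : Type) (r : T -> T -> Prop) : T -> Prop :=
  Acc (fun y x => r x y).

Lemma sn_step (T : Type) (r : T -> T -> Prop) (x y : T) :
  sn r x -> r x y -> sn r y.
Proof. by case=> accx rxy; apply: accx. Qed.

Lemma sn_no_infinite (T : Type) (r : T -> T -> Prop) (x : T) :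
  sn r x -> ~ exists s : nat -> T, s 0 = x /\ forall n, r (s n) (s n.+1).
Proof.
elim=> y _ IH [s [s0 rs]]; apply: (IH (s 1)); first by rewrite -s0.
by exists (fun n => s n.+1).
Qed.

(** Classically, an element that is not accessible has a successor that is not accessible. Choice
    makes this a function [f], whose iterates form an infinite sequence. *)
Lemma no_infinite_sn (T : Type) (r : T -> T -> Prop) (x : T) :
  ~ (exists s : nat -> T, s 0 = x /\ forall n, r (s n) (s n.+1)) -> sn r x.
Proof.
move=> noinf; apply: contrapT => nsnx.
have /choice[f fP] y : exists z, ~ sn r y -> r y z /\ ~ sn r z.
  have [sny|nsny] := pselect (sn r y); first by exists y.
  apply: contrapT => nz; apply: nsny; constructor=> z ryz.
  by apply: contrapT => nsnz; apply: nz; exists z.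
have nsn n : ~ sn r (iter n f x) by elim: n => [//|n /fP[]].
by apply: noinf; exists (fun n => iter n f x); split=> // n; have [] := fP _ (nsn n).
Qed.

Definition upd (n : nat) (T : Type) (ts : {ffun 'I_n -> T}) (i : 'I_n) (u : T) :
    {ffun 'I_n -> T} :=
  [ffun j => if j == i then u else ts j].

(** This serves for independent steps in the arguments of a fixed symbol. The auxiliary relation
    [q k] lets only coordinates below [k] move, which allows induction on [k]. *)
Lemma sn_prod (n : nat) (T : Type) (r : 'I_n -> T -> T -> Prop)
    (ts : {ffun 'I_n -> T}) :
  (forall i, sn (r i) (ts i)) ->
  sn (fun ts us : {ffun 'I_n -> T} => exists i u, r i (ts i) u /\ us = upd ts i u) ts.
Proof.
pose q k (ts us : {ffun 'I_n -> T}) :=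
  exists (i : 'I_n) u, [/\ i < k, r i (ts i) u & us = upd ts i u].
have sn_upd (us : {ffun 'I_n -> T}) i u : (forall j, sn (r j) (us j)) -> r i (us i) u ->
    forall j, sn (r j) (upd us i u j).
  move=> snus ru j; rewrite ffunE; case: eqP => [->|//].
  exact: sn_step (snus i) ru.
suff q_sn k : k <= n -> forall us : {ffun 'I_n -> T},
    (forall i, sn (r i) (us i)) -> sn (q k) us.
  move=> snts; elim: (q_sn n (leqnn n) _ snts) => us _ IH.
  constructor=> _ [i [u [ru ->]]].
  by apply: IH; exists i, u; split.
elim: k => [_ us _|k IHk lekn us snus].
  by constructor=> vs [i [u []]].
pose ik := Ordinal lekn.
move Ex: (us ik) => x; have snx : sn (r ik) x by rewrite -Ex.
(* The order is lexicographic: a move of coordinate [k] decreases [x] and restarts the induction for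
   [q k], while a move below [k] leaves [x] alone. *)
elim: snx us snus Ex => {}x _ IHx us snus Ex.
have snq := IHk (ltnW lekn) us snus.
elim: snq snus Ex => {}us _ IHus snus Ex.
constructor=> _ [i [u [lti ru ->]]].
move: lti; rewrite ltnS leq_eqVlt => /orP[/eqP eik|ltik].
  have {}eik : i = ik by apply: val_inj.
  subst i; apply: (IHx u); first by rewrite -Ex.
    exact: sn_upd.
  by rewrite ffunE eqxx.
apply: IHus; [by exists i, u; split|exact: sn_upd|].
by rewrite ffunE; case: eqP => // eik; move: ltik; rewrite -eik ltnn.
Qed.

Section Terms.
Variables (Sg : signature) (X : Type) (R : rules Sg X).

Lemma sn_arg (f : symbol Sg) (ts : {ffun 'I_(arity f) -> term Sg X}) i :
  sn (rewrite_step R) (App f ts) -> sn (rewrite_step R) (ts i).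
Proof.
move Et: (App f ts) => t snt; elim: snt ts Et => {}t _ IH ts Et.
constructor=> w rw; have := IH (App f (upd ts i w)) _ _ erefl.
by rewrite ffunE eqxx; apply; rewrite -Et; apply: step_arg.
Qed.

Lemma sn_Var (x : X) : is_trs R -> sn (rewrite_step R) (Var x).
Proof.
move=> trsR; constructor=> u; move E: (Var x) => t rt.
case: rt E => [l r s Rlr|//].
by have [] := trsR _ _ Rlr; case: l {Rlr}.
Qed.

End Terms.

(** * Labelling, substitution and the lifting of rewrite steps *)

Section Labelling.
Variables (Sg : signature) (X : Type) (A : partial_algebra Sg).
Implicit Types (t : term Sg X) (p q : term (lab_sig A) X) (alpha : X -> carrier A).

Lemma eval_App alpha (f : symbol Sg) (ts : {ffun 'I_(arity f) -> term Sg X}) b :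
  eval alpha (App f ts) = Some b <->
  exists v : {ffun 'I_(arity f) -> carrier A},
    (forall i, eval alpha (ts i) = Some (v i)) /\ interp v = Some b.
Proof.
rewrite /=; split.
  case Ev: (otuple _) => [v|//] /= iv; exists v; split=> // i.
  by move/otupleP/(_ i): Ev; rewrite ffunE.
case=> v [ev iv]; suff -> : otuple [ffun i => eval alpha (ts i)] = Some v by [].
by apply/otupleP => i; rewrite ffunE.
Qed.

Lemma lab_App alpha (f : symbol Sg) (ts : {ffun 'I_(arity f) -> term Sg X}) p :
  lab alpha (App f ts) = Some p <->
  exists (w : {v : {ffun 'I_(arity f) -> carrier A} | interp v})
      (ts' : {ffun 'I_(arity f) -> term (lab_sig A) X}),
    [/\ forall i, eval alpha (ts i) = Some (sval w i),
        forall i, lab alpha (ts i) = Some (ts' i)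
      & p = @App (lab_sig A) X (existT _ f w) ts'].
Proof.
rewrite /=; split.
  case Ev: (otuple _) => [v|//] /=; case: insubP => [w _ vw|//].
  case Eu: (otuple _) => [ts'|//] /= [<-]; exists w, ts'; split=> // i.
    by move/otupleP/(_ i): Ev; rewrite ffunE -vw.
  by move/otupleP/(_ i): Eu; rewrite ffunE.
case=> w [ts' [ew lw ->]].
have -> : otuple [ffun i => eval alpha (ts i)] = Some (val w).
  by apply/otupleP => i; rewrite ffunE.
rewrite valK.
suff -> : otuple [ffun i => lab alpha (ts i)] = Some ts' by [].
by apply/otupleP => i; rewrite ffunE.
Qed.

Lemma eval_subst_occurs alpha (s : X -> term Sg X) t x :
  eval alpha (subst s t) -> occurs x t -> eval alpha (s x).
Proof.
elim/term_ind': t => [y /= ? ->//|f ts IH].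
case E: (eval _ _) => [b|//] _ [i xi]; apply: IH xi.
by move/eval_App: E => [v [/(_ i) + _]]; rewrite ffunE => ->.
Qed.

Lemma eval_subst alpha beta (s : X -> term Sg X) t :
  (forall x, occurs x t -> eval alpha (s x) = Some (beta x)) ->
  eval alpha (subst s t) = eval beta t.
Proof.
elim/term_ind': t => [x /(_ x)->//|f ts IH] sb /=.
congr (obind _ (otuple _)); apply/ffunP => i; rewrite !ffunE; apply: IH => x xi.
by apply: sb; exists i.
Qed.

Lemma lab_subst alpha beta (s : X -> term Sg X) s' t p :
  (forall x, occurs x t -> eval alpha (s x) = Some (beta x)) ->
  (forall x, occurs x t -> lab alpha (s x) = Some (s' x)) ->
  lab beta t = Some p -> lab alpha (subst s t) = Some (subst s' p).
Proof.
elim/term_ind': t p => [x|f ts IH] p sb ss'.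
  by move=> [<-]; apply: ss'.
move/lab_App => [w [ts' [ew lw ->]]].
apply/lab_App; exists w, [ffun i => subst s' (ts' i)]; split=> // i; rewrite !ffunE.
  by rewrite -ew; apply: eval_subst => x xi; apply: sb; exists i.
by apply: IH => // x xi; [apply: sb|apply: ss']; exists i.
Qed.

(** A root step is lifted by the rule labelled under [beta], the values of the substituted terms.
    Labels above the redex stay the same because the model condition preserves its value. *)
Lemma rewrite_step_lab (R : rules Sg X) alpha t u :
  is_trs R -> partial_model R A -> rewrite_step R t u ->
  forall b p, eval alpha t = Some b -> lab alpha t = Some p ->
  eval alpha u = Some b /\
  exists2 q, lab alpha u = Some q & rewrite_step (lab_rules A R) p q.
Proof.
move=> trsR modR; elim=> [l r s Rlr|f ts i w rw IH] b p et lt.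
  have [_ occR] := trsR _ _ Rlr.
  (* The defaults here and in [s'] are never reached: the value of the redex is defined, hence so is
     that of [s x] for each variable of [l], and [r] has no others. *)
  pose beta x := odflt (alpha x) (eval alpha (s x)).
  pose s' x : term (lab_sig A) X := odflt (Var x) (lab alpha (s x)).
  have def x : occurs x l -> eval alpha (s x).
    by apply: eval_subst_occurs; rewrite et.
  have sb x : occurs x l -> eval alpha (s x) = Some (beta x).
    by move=> /def; rewrite /beta; case: eval.
  have ss' x : occurs x l -> lab alpha (s x) = Some (s' x).
    by move=> /def; rewrite /s' -labE; case: lab.
  have el : eval beta l = Some b by rewrite -(eval_subst sb).
  have [|er elr] := modR _ _ beta Rlr; first by rewrite el.
  split; first by rewrite (eval_subst (beta := beta)) -?elr // => x /occR/sb.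
  have := labE beta l; rewrite el; case ll: (lab beta l) => [l'|//] _.
  have := labE beta r; rewrite er; case lr: (lab beta r) => [r'|//] _.
  exists (subst s' r').
    by apply: (lab_subst (beta := beta)) lr => x /occR; [apply: sb|apply: ss'].
  move: lt; rewrite (lab_subst sb ss' ll) => -[<-].
  by apply: step_root; exists l, r, beta; split=> //; rewrite el.
move/lab_App: lt => [v [ts' [ev lv ->]]].
have [ew [w' lw' rw']] := IH _ _ (ev i) (lv i).
move/eval_App: et => [v' [ev' iv']].
have ev_upd j : eval alpha (upd ts i w j) = eval alpha (ts j).
  by rewrite ffunE; case: eqP => [->|//]; rewrite ew ev.
split; first by apply/eval_App; exists v'; split=> // j; rewrite -ev'; apply: ev_upd.
exists (@App (lab_sig A) X (existT _ f v) (upd ts' i w')); last exact: step_arg.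
apply/lab_App; exists v, (upd ts' i w'); split=> // j; first by rewrite -ev; apply: ev_upd.
by rewrite !ffunE; case: eqP.
Qed.

(** * Ground witnesses, sorts and caps *)

Lemma core_ground_term (a : carrier A) :
  core a -> exists t, ground t /\ forall alpha, eval alpha t = Some a.
Proof.
elim=> f v b _ IH iv; have [ts tsP] := choice IH.
exists (App f [ffun i => ts i]); split=> [x [i]|alpha].
  by rewrite ffunE; have [gi _] := tsP i; apply: gi.
by apply/eval_App; exists v; split=> // i; rewrite ffunE; have [_ ->] := tsP i.
Qed.

Definition lab_res (g : lab_symbol A) : carrier A := oget (svalP (tagged g)).

Lemma interp_lab_res (g : lab_symbol A) :
  interp (sval (tagged g)) = Some (lab_res g).
Proof. by rewrite /lab_res; case: (interp _) (svalP _). Qed.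

Lemma lab_res_eval alpha (f : symbol Sg) (ts : {ffun 'I_(arity f) -> term Sg X})
    (w : {v : {ffun 'I_(arity f) -> carrier A} | interp v}) b :
  eval alpha (App f ts) = Some b -> (forall i, eval alpha (ts i) = Some (sval w i)) ->
  lab_res (existT _ f w) = b.
Proof.
move=> /eval_App[v [ev iv]] ew; apply: Some_inj; rewrite -interp_lab_res -iv /=.
by congr interp; apply/ffunP => i; apply: Some_inj; rewrite -ev -ew.
Qed.

Variable witness : carrier A -> term Sg X.

Fixpoint cap (a : carrier A) (t : term (lab_sig A) X) : term Sg X :=
  match t with
  | Var _ => witness a
  | App g ts =>
      if `[< lab_res g = a >] then
        App (tag g) [ffun i => cap (sval (tagged g) i) (ts i)]
      else witness a
  end.

(** A labelled term is well-sorted down to its variables, so [cap] cuts only within the substituted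
    terms, entering [s x] at sort [alpha x]. *)
Lemma cap_subst_lab alpha (s : X -> term (lab_sig A) X) t p b :
  eval alpha t = Some b -> lab alpha t = Some p ->
  cap b (subst s p) = subst (fun x => cap (alpha x) (s x)) t.
Proof.
elim/term_ind': t p b => [x|f ts IH] p b; first by move=> [<-] [<-].
move=> et /lab_App[w [ts' [ew lw ->]]] /=.
case: asboolP => [_|[]]; last exact: lab_res_eval et ew.
by congr App; apply/ffunP => i; rewrite !ffunE; apply: IH.
Qed.

Hypothesis witnessP :
  forall a, ground (witness a) /\ forall alpha, eval alpha (witness a) = Some a.

Lemma ground_cap a p : ground (cap a p).
Proof.
elim/term_ind': p a => [x|g ts IH] a /=; first by have [] := witnessP a.
case: asboolP => _; last by have [] := witnessP a.
by move=> x [i]; rewrite ffunE; apply: IH.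
Qed.

Lemma eval_cap alpha a p : eval alpha (cap a p) = Some a.
Proof.
elim/term_ind': p a => [x|g ts IH] a; rewrite [cap _ _]/=.
  by have [_ ->] := witnessP a.
case: asboolP => [<-|_]; last by have [_ ->] := witnessP a.
apply/eval_App; exists (sval (tagged g)); split; last exact: interp_lab_res.
by move=> i; rewrite ffunE.
Qed.

Lemma language_cap a p : language X A (cap a p).
Proof.
split; first exact: ground_cap.
by exists (fun=> a); rewrite eval_cap.
Qed.

(** * Steps in the cap and steps in the aliens *)

Variable R : rules Sg X.
Hypotheses (R_trs : is_trs R) (R_nc : non_collapsing R) (A_model : partial_model R A).

Local Notation lab_step := (rewrite_step (lab_rules A R)).

Fixpoint sn_aliens (a : carrier A) (t : term (lab_sig A) X) : Prop :=
  match t with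
  | Var _ => True
  | App g ts =>
      if `[< lab_res g = a >] then
        forall i, sn_aliens (sval (tagged g) i) (ts i)
      else sn lab_step t
  end.

Fixpoint alien_step (a : carrier A) (t u : term (lab_sig A) X) : Prop :=
  match t with
  | Var _ => False
  | App g ts =>
      if `[< lab_res g = a >] then
        exists i w, alien_step (sval (tagged g) i) (ts i) w /\ u = App g (upd ts i w)
      else lab_step t u
  end.

Lemma sn_sn_aliens a p : sn lab_step p -> sn_aliens a p.
Proof.
elim/term_ind': p a => [//|g ts IH] a snt /=; case: asboolP => // _ i.
exact/IH/(sn_arg _ snt).
Qed.

Lemma sn_aliens_subst_lab alpha (s : X -> term (lab_sig A) X) t p b :
  eval alpha t = Some b -> lab alpha t = Some p ->
  sn_aliens b (subst s p) <-> forall x, occurs x t -> sn_aliens (alpha x) (s x).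
Proof.
elim/term_ind': t p b => [x|f ts IH] p b.
  by move=> [<-] [<-]; split=> [? _ ->|] //; apply.
move=> et /lab_App[w [ts' [ew lw ->]]] /=.
case: asboolP => [_|[]]; last exact: lab_res_eval et ew.
split=> [H x [i xi]|H i].
  by have := H i; rewrite ffunE => /(IH i _ _ (ew i) (lw i)); apply.
by rewrite ffunE; apply/(IH i _ _ (ew i) (lw i)) => x xi; apply: H; exists i.
Qed.

Lemma subst_lab_App alpha (s : X -> term (lab_sig A) X) t p b :
  ~~ is_var t -> eval alpha t = Some b -> lab alpha t = Some p ->
  exists (g : lab_symbol A) ts,
    lab_res g = b /\ subst s p = @App (lab_sig A) X g ts.
Proof.
case: t => [//|f ts] _ et /lab_App[w [ts' [ew lw ->]]].
exists (existT _ f w), [ffun i => subst s (ts' i)]; split=> //.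
exact: lab_res_eval et ew.
Qed.

Variant root_step (s : X -> term (lab_sig A) X) (l' r' : term (lab_sig A) X) : Prop :=
  RootStep l r alpha b (g h : lab_symbol A) ts us of
    R l r & eval alpha l = Some b & eval alpha r = Some b
    & lab alpha l = Some l' & lab alpha r = Some r'
    & lab_res g = b & lab_res h = b
    & subst s l' = @App (lab_sig A) X g ts & subst s r' = @App (lab_sig A) X h us.

(** Non-collapsing enters here: both sides keep a root symbol of their own under [s], and the model
    condition gives these symbols the same sort. *)
Lemma root_stepP s l' r' : lab_rules A R l' r' -> root_step s l' r'.
Proof.
move=> [l [r [alpha [Rlr el ll lr]]]].
have [nvl _] := R_trs Rlr; have nvr := R_nc Rlr.
have [_] := A_model Rlr el; case E: (eval alpha l) el => [b|//] _ /esym er.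
have [g [ts [gb lE]]] := subst_lab_App s nvl E ll.
have [h [us [hb rE]]] := subst_lab_App s nvr er lr.
exact: (RootStep Rlr E er ll lr gb hb lE rE).
Qed.

(** A root step in the cap may copy or erase aliens but creates none, as the variables of [r] occur
    in [l]. *)
Lemma sn_aliens_step a p q : lab_step p q -> sn_aliens a p -> sn_aliens a q.
Proof.
move=> rt; elim: rt a => [l' r' s lab_lr|g ts i w rw IH] a; last first.
  have rgw := @step_arg _ _ _ g ts i w rw; move: rgw => /=.
  case: asboolP => [_ _ H j|_ rgw snt]; last exact: sn_step snt rgw.
  by rewrite ffunE; case: eqP => [->|//]; apply: IH.
have [l r alpha b g h ts us Rlr el er ll lr gb hb lE rE] := root_stepP s lab_lr.
have [<-{a}|ab] := pselect (b = a).
  move=> /(sn_aliens_subst_lab s el ll) H; apply/(sn_aliens_subst_lab s er lr) => x xr.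
  by apply: H; have [_] := R_trs Rlr; apply.
have := step_root s lab_lr; rewrite lE rE /= gb hb.
by case: asboolP => [/ab []|_ rgh snt]; exact: sn_step snt rgh.
Qed.

Lemma lab_step_cap_or_alien a p q : lab_step p q ->
  rewrite_step R (cap a p) (cap a q) \/
  (alien_step a p q /\ cap a q = cap a p).
Proof.
move=> rt; elim: rt a => [l' r' s lab_lr|g ts i w rw IH] a; last first.
  have rgw := @step_arg _ _ _ g ts i w rw; move: rgw => /=.
  case: asboolP => [_ _|_]; last by right.
  have capE : [ffun j => cap (sval (tagged g) j) (upd ts i w j)] =
      upd [ffun j => cap (sval (tagged g) j) (ts j)] i (cap (sval (tagged g) i) w).
    by apply/ffunP => j; rewrite !ffunE; case: eqP => [->|].
  rewrite -[finfun (fun j => if j == i then w else ts j)]/(upd ts i w) capE.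
  case: (IH (sval (tagged g) i)) => [rcap|[rali capw]]; [left|right].
    by apply: step_arg; rewrite ffunE.
  split; first by exists i, w.
  by congr App; apply/ffunP => j; rewrite !ffunE; case: eqP => [->|].
have [l r alpha b g h ts us Rlr el er ll lr gb hb lE rE] := root_stepP s lab_lr.
have [<-{a}|ab] := pselect (b = a).
  left; rewrite (cap_subst_lab s el ll) (cap_subst_lab s er lr).
  exact: step_root.
(* The sort [b] of redex and contractum differs from [a], so both are aliens and both caps are
   [witness a]. *)
right; have := step_root s lab_lr; rewrite lE rE /= gb hb.
by case: asboolP.
Qed.

Lemma alien_step_sub a p q : alien_step a p q -> lab_step p q.
Proof.
elim/term_ind': p a q => [//|g ts IH] a q /=; case: asboolP => // _.
by move=> [i [w [/IH rw ->]]]; apply: step_arg.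
Qed.

(** Within one alien these are ordinary labelled steps; distinct aliens move independently, which
    [sn_prod] handles. *)
Lemma sn_alien_step a p : sn_aliens a p -> sn (alien_step a) p.
Proof.
elim/term_ind': p a => [x a _|g ts IH a]; first by constructor.
rewrite /=; case: asboolP => [ga|nga] snts; last first.
  elim: snts => u _ IHu; constructor=> w /alien_step_sub; exact: IHu.
have := sn_prod (fun i => IH i _ (snts i)).
elim=> {snts} us _ IHus; constructor=> u /=.
case: asboolP => [_ [i [w [rw ->]]]|[]//].
by apply: IHus; exists i, w.
Qed.

(** The outer induction is on the cap, the inner one on alien steps with the cap fixed. As a cap
    step may duplicate aliens, the inner induction is restarted through [sn_aliens_step]. *)
Lemma sn_cap_aliens a p :
  sn (rewrite_step R) (cap a p) -> sn_aliens a p -> sn lab_step p.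
Proof.
move Ec: (cap a p) => c snc; elim: snc p Ec => {}c _ IHc p Ec snt.
have sna := sn_alien_step snt.
elim: sna Ec snt => {}p _ IHt Ec snt.
constructor=> q rt; have snu := sn_aliens_step rt snt.
case: (lab_step_cap_or_alien a rt) => [rcap|[rali capE]].
  by apply: (IHc (cap a q)) => //; rewrite -Ec.
by apply: IHt => //; rewrite capE.
Qed.

Lemma sn_lab p : terminating_on R (language X A) -> sn lab_step p.
Proof.
move=> termR; elim/term_ind': p => [x|g ts IH].
  exact/sn_Var/lab_rules_trs.
(* At its own sort the root belongs to the cap, so all aliens lie within the arguments. *)
apply: (@sn_cap_aliens (lab_res g)).
  exact/no_infinite_sn/termR/language_cap.
by rewrite /=; case: asboolP => [_ i|[]//]; exact/sn_sn_aliens/IH.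
Qed.

End Labelling.

Theorem theorem6p4 (Sg : signature) (X : Type) (R : rules Sg X)
    (A : partial_algebra Sg) (R_trs : is_trs R) (R_nc : non_collapsing R)
    (A_core : is_core A) (A_model : partial_model R A) :
  terminating_on R (language X A) <->
  terminating_on (lab_rules A R) (fun _ : term (lab_sig A) X => True).
Proof.
split=> [termR p _|termL t [_ [alpha et]] [s [s0 rs]]].
  have [witness witnessP] :=
    choice (fun a => core_ground_term X (A_core a)).
  exact: (sn_no_infinite (sn_lab witnessP R_trs R_nc A_model p termR)).
have := labE alpha t; rewrite et; case lt: (lab alpha t) => [p|//] _.
case et: (eval alpha t) et => [b|//] _.
(* The value [b] is invariant along the sequence, so every [s n] can be labelled. *)
have sP n : eval alpha (s n) = Some b /\ exists q, lab alpha (s n) = Some q.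
  elim: n => [|n [en [q ln]]]; first by rewrite s0; split; last exists p.
  have [en1 [w' lw _]] := rewrite_step_lab R_trs A_model (rs n) en ln.
  by split=> //; exists w'.
have [s' s'P] := choice (fun n => proj2 (sP n)).
apply: (termL (s' 0) I); exists s'; split=> // n; have [en _] := sP n.
have [_ [w' lw]] := rewrite_step_lab R_trs A_model (rs n) en (s'P n).
(* [lab] is a function, so the target of the lifted step is the chosen label [s' n.+1]. *)
by move: lw; rewrite s'P => -[<-].
Qed.
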